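(* Let $R$ be a commutative ring with identity and let $M$ be an $R$-module. The following are equivalent: (a) $M$ is a comorphic $R$-module; (b) for every submodule $N$ of $M$ such that $M/N$ is a finitely cogenerated $R$-module, there exists $a\in R$ such that $N=aM$ and $(N:_RM)=Ra+\mathrm{Ann}_R(M)$.
   Context: A proper submodule $N$ of an $R$-module $M$ is completely irreducible if whenever $N=\bigcap_{i\in I}N_i$ for a family $\{N_i\}_{i\in I}$ of submodules of $M$, then $N=N_i$ for some $i\in I$. For a submodule $N$ of $M$, $(N:_RM)=\{r\in R: rM\subseteq N\}$, and $\mathrm{Ann}_R(M)=\{r\in R: rM=0\}$. An $R$-module $M$ is comorphic if for each completely irreducible submodule $L$ of $M$ there exists $a\in R$ such that $L=aM$ and $(L:_RM)=Ra+\mathrm{Ann}_R(M)$. A module is finitely cogenerated if every family of its submodules with zero intersection has a finite subfamily with zero intersection. *)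

(* Defs.v *)
From HB Require Import structures.
From mathcomp Require Import all_boot all_algebra.
From mathcomp Require Import boolp classical_sets cardinality.

Set Implicit Arguments.
Unset Strict Implicit.
Unset Printing Implicit Defensive.

Import GRing.Theory.

Local Open Scope ring_scope.
Local Open Scope quotient_scope.
Local Open Scope classical_set_scope.

Section QuotientModule.
Variables (R : pzRingType) (M : lmodType R) (N : submodClosed M).

Fact submod_zmod_closed : zmod_closed (N : {pred M}).
Proof. exact: GRing.submod_closedB (submodClosedP N). Qed.

(* [submodClosed] is defined over semirings and so carries no closure under
   opposite, which the additive quotient [Quotient.quot] requires. *)
Definition submod_zmodClosed : zmodClosed M :=
  HB.pack (N : {pred M})
    (GRing.isZmodClosed.Build M (N : {pred M}) submod_zmod_closed).

Definition lquot : Type := Quotient.quot submod_zmodClosed.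
HB.instance Definition _ := GRing.Zmodule.on lquot.
HB.instance Definition _ := EqQuotient.on lquot.

Definition lquot_scale (a : R) : lquot -> lquot := lift_op1 lquot ( *:%R a).

Fact pi_lquot_scale a (x : M) :
  lquot_scale a (\pi_lquot x) = \pi_lquot (a *: x).
Proof.
rewrite /lquot_scale; unlock.
apply/eqP; rewrite -(Quotient.idealrBE submod_zmodClosed) -scalerBr.
by apply: (@rpredZ _ _ N); rewrite (Quotient.idealrBE submod_zmodClosed) reprK.
Qed.

Let piD (x y : M) : \pi_lquot x + \pi_lquot y = \pi_lquot (x + y).
Proof. by rewrite (raddfD (\pi_(Quotient.quot submod_zmodClosed))). Qed.

Fact lquot_scalerA a b v :
  lquot_scale a (lquot_scale b v) = lquot_scale (a * b) v.
Proof. by rewrite -[v]reprK !pi_lquot_scale scalerA. Qed.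

Fact lquot_scale1r : left_id 1 lquot_scale.
Proof. by move=> v; rewrite -[v]reprK pi_lquot_scale scale1r. Qed.

Fact lquot_scalerDr : right_distributive lquot_scale +%R.
Proof.
by move=> a u v; rewrite -[u]reprK -[v]reprK piD !pi_lquot_scale piD scalerDr.
Qed.

Fact lquot_scalerDl v : {morph lquot_scale^~ v : a b / a + b}.
Proof.
by move=> a b; rewrite -[v]reprK !pi_lquot_scale piD scalerDl.
Qed.

HB.instance Definition _ := GRing.Zmodule_isLmodule.Build R lquot
  lquot_scalerA lquot_scale1r lquot_scalerDr lquot_scalerDl.

Fact lquot_scaleE a (x : M) : \pi_lquot (a *: x) = a *: \pi_lquot x.
Proof. by rewrite -pi_lquot_scale. Qed.

Fact pi_lquot_eq0 (x : M) : (\pi_lquot x == 0 :> lquot) = (x \in N).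
Proof.
have -> : (0 : lquot) = \pi_lquot 0.
  by rewrite (raddf0 (\pi_(Quotient.quot submod_zmodClosed))).
by rewrite -(Quotient.idealrBE submod_zmodClosed) subr0.
Qed.

End QuotientModule.

Section Comorphic.
Variables (R : comPzRingType) (M : lmodType R).

Definition completely_irreducible (N : submodClosed M) : Prop :=
  [set` N] <> [set: M] /\
  forall (I : Type) (F : I -> submodClosed M),
    [set` N] = \bigcap_i [set` F i] -> exists i, [set` N] = [set` F i].

Definition residual (N : submodClosed M) : set R :=
  [set r | forall m : M, r *: m \in N].

Definition annihilator : set R := [set r | forall m : M, r *: m = 0].

Definition principal_plus_annihilator (a : R) : set R :=
  [set s * a + t | s in [set: R] & t in annihilator].

Definition scalar_multiple (a : R) : set M := range (fun m : M => a *: m).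

Definition comorphic : Prop :=
  forall L : submodClosed M, completely_irreducible L ->
    exists a : R,
      [set` L] = scalar_multiple a /\
      residual L = principal_plus_annihilator a.

(* Intersections are taken inside [M], so the empty one is [M] itself; in
   particular the zero module is finitely cogenerated. *)
Definition finitely_cogenerated : Prop :=
  forall (I : Type) (F : I -> submodClosed M),
    \bigcap_i [set` F i] = [set 0] ->
    exists2 J : set I, finite_set J & \bigcap_(i in J) [set` F i] = [set 0].

End Comorphic.

Arguments annihilator {R} M.
Arguments principal_plus_annihilator {R} M a.
Arguments scalar_multiple {R} M a.
Arguments comorphic {R} M.
Arguments finitely_cogenerated {R} M.

(* Main.v *)
(** (b) => (a) holds because [M/L] is finitely cogenerated for [L] completely
irreducible.  For (a) => (b), Zorn's lemma writes [N] as an intersection of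
completely irreducible submodules, and finite cogeneration of [M/N] makes the
intersection finite.  Finite intersections are then handled one factor at a
time: if [K = bM] with [(K : M) = Rb + Ann M], and [L] is completely
irreducible with [K] not contained in [L], then [(L :_M b)] is again completely
irreducible, hence equal to some [cM] with [(cM : M) = Rc + Ann M]; therefore
[K \cap L = b (L :_M b) = bcM], and [sb + t] with [t] in [Ann M] maps [M] into
[L] iff [s] lies in [(cM : M)]. *)

Require Import Defs.
From HB Require Import structures.
From mathcomp Require Import all_boot all_algebra.
From mathcomp Require Import boolp classical_sets cardinality.

Set Implicit Arguments.
Unset Strict Implicit.

Import GRing.Theory.

Local Open Scope ring_scope.
Local Open Scope classical_set_scope.

Section Submodules.
Variables (R : pzRingType) (M : lmodType R).

(** Membership in a [submodClosed] is boolean, so the propositional set [S] is made decidable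
    classically by [asbool]. *)
Lemma submodClosed_of_set (S : set M) :
    S 0 -> (forall (a : R) (x y : M), S x -> S y -> S (a *: x + y)) ->
  exists L : submodClosed M, [set` L] = S.
Proof.
move=> S0 Slin.
have closedS : GRing.subsemimod_closed (fun x : M => `[< S x >]).
  split; first split; first exact/asboolP.
    move=> x y /asboolP Sx /asboolP Sy; apply/asboolP.
    by rewrite -[x]scale1r; exact: Slin.
  by move=> a x /asboolP Sx; apply/asboolP; rewrite -[_ *: _]addr0; exact: Slin.
pose L : submodClosed M := HB.pack (fun x : M => `[< S x >])
  (GRing.isSubmodClosed.Build R M (fun x : M => `[< S x >]) closedS).
by exists L; apply/seteqP; split=> x /asboolP.
Qed.

Lemma submodClosed_lin (L : submodClosed M) (a : R) (x y : M) :
  x \in L -> y \in L -> a *: x + y \in L.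
Proof. by move=> Lx Ly; rewrite rpredD // rpredZ. Qed.

Lemma submodClosedB (L : submodClosed M) (x y : M) :
  x \in L -> y \in L -> x - y \in L.
Proof. by move=> Lx Ly; rewrite addrC -scaleN1r submodClosed_lin. Qed.

End Submodules.

(** * Submodules of [M/N] and submodules of [M] containing [N] *)

Section LquotSubmodules.
Variables (R : pzRingType) (M : lmodType R) (N : submodClosed M).
Local Notation pi := (\pi_(lquot N))%qT.

Lemma pi_lquot_lin (a : R) (x y : M) : pi (a *: x + y) = a *: pi x + pi y.
Proof.
rewrite -lquot_scaleE.
exact: (raddfD (\pi_(Quotient.quot (submod_zmodClosed N)))%qT).
Qed.

Lemma pi_lquot0 : pi 0 = 0.
Proof. by apply/eqP; rewrite pi_lquot_eq0 rpred0. Qed.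

Lemma lquot_preim (F : submodClosed (lquot N)) :
  exists L : submodClosed M, forall x, (x \in L) = (pi x \in F).
Proof.
have [||L LE] := @submodClosed_of_set _ _ [set x | pi x \in F].
- by rewrite /= pi_lquot0 rpred0.
- by move=> a x y /= Fx Fy; rewrite pi_lquot_lin rpredD // rpredZ.
by exists L => x; exact/is_true_inj/(congr1 (@^~ x) LE).
Qed.

(** Since [N] lies in [L], membership in [L] does not depend on the representative of a class. *)
Lemma lquot_image (L : submodClosed M) : [set` N] `<=` [set` L] ->
  exists F : submodClosed (lquot N), forall x, (pi x \in F) = (x \in L).
Proof.
move=> NL.
have [||F FE] := @submodClosed_of_set _ _ [set pi x | x in [set` L]].
- by exists 0; rewrite ?pi_lquot0 //= rpred0.
- move=> a _ _ [x Lx <-] [y Ly <-]; exists (a *: x + y); rewrite ?pi_lquot_lin //=.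
  exact: submodClosed_lin.
have FP q : q \in F <-> [set pi x | x in [set` L]] q by rewrite -FE.
exists F => x; apply/idP/idP => [/FP[y Ly yx] | Lx]; last by apply/FP; exists x.
have /NL Lxy : x - y \in N.
  have := pi_lquot_lin (-1) y x; rewrite scaleN1r addrC => exy.
  by rewrite -pi_lquot_eq0 exy yx scaleN1r addrC subrr.
by rewrite -[x](subrK y) rpredD.
Qed.

End LquotSubmodules.

Section CompletelyIrreducible.
Variables (R : comPzRingType) (M : lmodType R).

(* Take [L] maximal among the submodules containing [N] and avoiding [x].  The
   Zorn predicate also has to hold for the union of the empty chain, hence the
   shift by [N]. *)
Lemma exists_completely_irreducible (N : submodClosed M) (x : M) :
  x \notin N ->
  exists L : submodClosed M,
    [/\ completely_irreducible L, [set` N] `<=` [set` L] & x \notin L].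
Proof.
move=> xN.
pose P (X : set M) := exists2 L : submodClosed M,
  [set` L] = [set` N] `|` X & x \notin L.
have [C CP Ctot|X [[L LE xL] Xmax]] := @Zorn_bigcup M P.
  have [||L LE] := @submodClosed_of_set R M ([set` N] `|` \bigcup_(X in C) X).
  - by left; rewrite /= rpred0.
  - have closed X a u v : C X -> ([set` N] `|` X) u -> ([set` N] `|` X) v ->
        ([set` N] `|` \bigcup_(Y in C) Y) (a *: u + v).
      move=> CX; have [K KE _] := CP _ CX; rewrite -KE => Ku Kv.
      have : [set` K] (a *: u + v) by exact: submodClosed_lin.
      by rewrite KE => -[Nuv|Xuv]; [left|right; exists X].
    move=> a u v [Nu|[X CX Xu]] [Nv|[Y CY Yv]].
    + by left; exact: submodClosed_lin.
    + by apply: (closed Y) => //; [left|right].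
    + by apply: (closed X) => //; [right|left].
    + have [XY|YX] := Ctot _ _ CX CY.
        by apply: (closed Y) => //; right => //; exact: XY.
      by apply: (closed X) => //; right => //; exact: YX.
  exists L => //; apply/negP => Lx.
  have : [set` L] x by [].
  rewrite LE => -[Nx|[X CX Xx]]; first by case/negP: xN.
  have [K KE /negP[]] := CP _ CX.
  suff : [set` K] x by [].
  by rewrite KE; right.
have NL : [set` N] `<=` [set` L] by rewrite LE; exact: subsetUl.
exists L; split=> //; split=> [LT|I F LF].
  by case/negP: xL; suff: [set` L] x by []; rewrite LT.
(* As [x] is not in [L], some [F i] misses [x]; it contains [L], so maximality forces equality. *)
have [i xFi] : exists i, x \notin F i.
  apply: contrapT => nF; case/negP: xL.
  suff : [set` L] x by [].
  by rewrite LF => i _ /=; apply: contrapT => xF; apply: nF; exists i; apply/negP.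
have LFi : [set` L] `<=` [set` F i] by rewrite LF => y; apply.
exists i; apply: contrapT => neq.
apply: (Xmax [set` F i]).
  split=> [y Xy|FX]; first by apply: LFi; rewrite LE; right.
  apply: neq; apply/seteqP; split=> // y /FX Xy.
  by rewrite LE; right.
by exists (F i) => //; apply/esym/setUidPr; exact: (subset_trans NL).
Qed.

(** If [K = (L :_M b)] is the intersection of the [F i], then [L] is the intersection of the
    submodules [b (F i) + L]. Hence [L] is one of these, and for that [i], [F i] lies in [K]. *)
Lemma completely_irreducible_colon (L : submodClosed M) (b : R) :
  completely_irreducible L -> ~ (forall x, b *: x \in L) ->
  exists2 K : submodClosed M, completely_irreducible K &
    forall x, (x \in K) = (b *: x \in L).
Proof.
move=> [_ Lirr] bL.
have [||K KE] := @submodClosed_of_set R M [set x | b *: x \in L].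
- by rewrite /= scaler0 rpred0.
- move=> a x y /= Lx Ly; rewrite scalerDr scalerA mulrC -scalerA.
  exact: submodClosed_lin.
have KP x : (x \in K) = (b *: x \in L).
  exact/is_true_inj/(congr1 (@^~ x) KE).
exists K => //; split=> [KT|I F KF].
  by apply: bL => x; rewrite -KP; suff: [set` K] x by []; rewrite KT.
have Fin i x : x \in K -> x \in F i.
  by move=> Kx; have : [set` K] x by []; rewrite KF; apply.
(* [G i] is [b (F i) + L]. *)
have /choice[G GE] i : exists G : submodClosed M,
    [set` G] = [set z | exists2 x, x \in F i & z - b *: x \in L].
  apply: submodClosed_of_set => [|a y z [u Fu Lu] [v Fv Lv]].
    by exists 0; rewrite ?scaler0 ?subr0 rpred0.
  exists (a *: u + v); first exact: submodClosed_lin.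
  have -> : a *: y + z - b *: (a *: u + v)
          = a *: (y - b *: u) + (z - b *: v).
    by rewrite scalerDr scalerBr !scalerA [b * a]mulrC opprD addrACA.
  exact: submodClosed_lin.
(* An empty family would give [K = M], against [bL]. *)
have [i0 _] : exists i0 : I, True.
  apply: contrapT => I0; apply: bL => x; rewrite -KP.
  suff : [set` K] x by [].
  by rewrite KF => i; case: I0; exists i.
have [|i LGi] := Lirr I G.
  apply/seteqP; split=> z.
    by move=> Lz i _; rewrite GE; exists 0; rewrite ?scaler0 ?subr0 ?rpred0.
  move=> Gz; have := Gz i0 Logic.I; rewrite GE => -[u Fu Lu].
  (* For each [j], [z] is also [b v] modulo [L] with [v] in [F j]; then [u - v] is in [K], hence in
     [F j], and so is [u]. *)
  have Ku : [set` K] u.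
    rewrite KF => j _; have := Gz j Logic.I; rewrite GE => -[v Fv Lv].
    have Kuv : u - v \in K.
      rewrite KP scalerBr.
      have -> : b *: u - b *: v = (z - b *: v) - (z - b *: u).
        by rewrite opprB [RHS]addrC addrA subrK.
      exact: submodClosedB.
    by rewrite /= -[u](subrK v) rpredD // Fin.
  by rewrite /= -[z](subrK (b *: u)) rpredD // -KP.
exists i; apply/seteqP; split=> x; first exact: Fin.
move=> Fx /=; rewrite KP; suff : [set` L] (b *: x) by [].
by rewrite LGi GE; exists x; rewrite // subrr rpred0.
Qed.

(** A family with zero intersection in [M/L] pulls back to one with intersection [L]. Some pullback
    equals [L], so a single member is already zero. *)
Lemma completely_irreducible_finitely_cogenerated (L : submodClosed M) :
  completely_irreducible L -> finitely_cogenerated (lquot L).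
Proof.
move=> [_ Lirr] I F F0.
have /choice[G GE] i := lquot_preim (F i).
have [|i LGi] := Lirr I G.
  apply/seteqP; split=> x.
    move=> Lx i _ /=; rewrite GE.
    by have /eqP-> : \pi_(lquot L)%qT x == 0; rewrite ?pi_lquot_eq0 ?rpred0.
  move=> Gx /=; rewrite -pi_lquot_eq0; apply/eqP.
  suff : [set 0] (\pi_(lquot L)%qT x) by [].
  by rewrite -F0 => i _ /=; rewrite -GE; exact: Gx.
exists [set i]; first exact: finite_set1.
rewrite bigcap_set1; apply/seteqP; split=> q /=; last by move=> ->; rewrite rpred0.
rewrite -[q]reprK -GE => Gq; apply/eqP; rewrite pi_lquot_eq0.
by suff : [set` L] (repr q) by []; rewrite LGi.
Qed.

(* On [S = [set` N]] this unfolds to the two conditions of the theorem. *)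
Definition comorphic_witness (S : set M) (a : R) : Prop :=
  S = scalar_multiple M a /\
  [set r | forall m : M, S (r *: m)] = principal_plus_annihilator M a.

Lemma comorphic_witness_setT : comorphic_witness setT 1.
Proof.
split; first by apply/seteqP; split=> x // _; exists x => //; rewrite scale1r.
apply/seteqP; split=> r //= _; exists r => //; exists 0; rewrite ?mulr1 ?addr0 //.
by move=> m; rewrite scale0r.
Qed.

Lemma comorphic_witnessI (S : set M) (b : R) (L : submodClosed M) :
  comorphic M -> comorphic_witness S b -> completely_irreducible L ->
  exists a, comorphic_witness ([set` L] `&` S) a.
Proof.
move=> Mco [SE resS] Lirr.
(* In the first case [S = bM] lies in [L] and [b] still serves; otherwise [(L :_M b)] is proper. *)
have [bL|bL] := pselect (forall x, b *: x \in L).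
  exists b; suff -> : [set` L] `&` S = S by [].
  by apply/setIidPr; rewrite SE => _ [x _ <-]; exact: bL.
have [K Kirr KP] := completely_irreducible_colon Lirr bL.
have [c [KE resK]] := Mco K Kirr.
have bcL x : b *: (c *: x) \in L.
  by rewrite -KP; suff : [set` K] (c *: x) by []; rewrite KE; exists x.
exists (b * c); split; apply/seteqP; split.
- move=> x [/= Lx]; rewrite SE => -[y _ yx].
  have : [set` K] y by rewrite /= KP yx.
  by rewrite KE => -[z _ zy]; exists z => //; rewrite -scalerA zy.
- move=> _ [x _ <-]; rewrite -scalerA; split; first exact: bcL.
  by rewrite SE; exists (c *: x).
- move=> r /= rLS.
  have : [set r | forall m : M, S (r *: m)] r by move=> m; case: (rLS m).
  rewrite resS => -[s _ [t tM rE]].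
  have : residual K s.
    move=> m; rewrite KP scalerA mulrC.
    by have [/=] := rLS m; rewrite -rE scalerDl tM addr0.
  rewrite resK => -[u _ [v vM sE]].
  (* From [r = s b + t] and [s = u c + v] one gets [r = u (b c) + (v b + t)], where [v b + t] kills
     [M]. *)
  exists u => //; exists (v * b + t).
    by move=> m; rewrite scalerDl tM addr0 mulrC -scalerA vM scaler0.
  by rewrite -rE -sE mulrDl addrA -!mulrA [c * b]mulrC.
- move=> r [u _ [t tM <-]] m.
  have -> : (u * (b * c) + t) *: m = b *: (c *: (u *: m)).
    by rewrite scalerDl tM addr0 !scalerA mulrC.
  by split; [exact: bcL | rewrite SE; exists (c *: (u *: m))].
Qed.

Lemma comorphic_witness_bigcap (I : choiceType) (L : I -> submodClosed M)
    (s : seq I) :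
  comorphic M -> (forall i, completely_irreducible (L i)) ->
  exists a, comorphic_witness (\bigcap_(i in [set` s]) [set` L i]) a.
Proof.
move=> Mco Lirr; rewrite bigcap_seq; elim: s => [|i s [b IHs]].
  by exists 1; rewrite big_nil; exact: comorphic_witness_setT.
by rewrite big_cons; exact: comorphic_witnessI Mco IHs (Lirr i).
Qed.

(** The family is indexed by the elements outside [N], each avoided by its own [L i]. The images of
    the [L i] in [M/N] meet in zero, so finitely many suffice. *)
Lemma finitely_cogenerated_bigcap (N : submodClosed M) :
  finitely_cogenerated (lquot N) ->
  exists (I : choiceType) (L : I -> submodClosed M) (s : seq I),
    (forall i, completely_irreducible (L i)) /\
    [set` N] = \bigcap_(i in [set` s]) [set` L i].
Proof.
move=> Nfc; pose I : choiceType := {x : M | x \notin N}.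
have /choice[L LP] (i : I) := exists_completely_irreducible (valP i).
have NL i : [set` N] `<=` [set` L i] by case: (LP i).
have /choice[F FE] i := lquot_image (NL i).
have [|J /finite_seqP[s ->] JE] := Nfc I F.
  apply/seteqP; split=> q; last by move=> -> i _; rewrite /= rpred0.
  rewrite -[q]reprK => Fq /=; apply/eqP; rewrite pi_lquot_eq0.
  apply: contrapT => /negP qN; pose i : I := Sub (repr q) qN.
  have [_ _ /negP[]] := LP i.
  by rewrite SubK -FE; exact: Fq.
exists I, L, s; split=> [i|]; first by case: (LP i).
apply/seteqP; split=> [x Nx i _|x Lx]; first exact: NL.
rewrite /= -pi_lquot_eq0; apply/eqP.
suff : [set 0] (\pi_(lquot N)%qT x) by [].
by rewrite -JE => i si /=; rewrite FE; exact: Lx.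
Qed.

End CompletelyIrreducible.

Theorem theorem2p6 (R : comPzRingType) (M : lmodType R) :
  comorphic M <->
  (forall N : submodClosed M, finitely_cogenerated (lquot N) ->
     exists a : R,
       [set` N] = scalar_multiple M a /\
       residual N = principal_plus_annihilator M a).
Proof.
split=> [Mco N /finitely_cogenerated_bigcap[I [L [s [Lirr NE]]]] | Mb L Lirr].
  (* [comorphic_witness] depends only on the underlying set, which permits rewriting with [NE]. *)
  suff : exists a, comorphic_witness [set` N] a by [].
  by rewrite NE; exact: comorphic_witness_bigcap.
exact/Mb/completely_irreducible_finitely_cogenerated.
Qed.
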